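(* Let $G$ be a finite graph, $\mathcal L$ a non-trivial linear class of bonds of $G$, and $X\subseteq E(G)$. Then the rank of $X$ in the join matroid $J(G,\mathcal L)$ is (1) $|V(G)|-|\pi_X|-1$ when $\pi_X$ is cobalanced, and (2) $|V(G)|-|\pi_X|$ when $\pi_X$ is un-cobalanced, where $|\pi_X|$ is the number of parts of $\pi_X$.
   Context: Graphs are finite, loops and multiple edges allowed. A bond is a minimal nonempty edge cut; $\delta(X)$ is the set of links with exactly one endpoint in a vertex set $X$. A tribond is $\delta(X_1)\cup\delta(X_2)\cup\delta(X_3)$ for a partition $\{X_1,X_2,X_3\}$ of the vertex set of one connected component into nonempty sets with each $G[X_i]$ connected and an edge joining each pair. A linear class of bonds is a set $\mathcal L$ of bonds such that for each such tripartition the number of $i$ with $\delta(X_i)\in\mathcal L$ is never exactly two; it is trivial if it contains every bond; bonds in $\mathcal L$ are cobalanced. A modular pair of bonds $B_1,B_2$ is one for which $G-(B_1\cup B_2)$ has two more components than $G$; a dibond is the union of a modular pair that is not a tribond. For non-trivial $\mathcal L$, $J_0(G,\mathcal L)$ is the matroid on $E(G)\cup\{e_0\}$ whose cocircuits are the bonds in $\mathcal L$, the sets $B\cup\{e_0\}$ for bonds $B\notin\mathcal L$, and the tribonds and dibonds containing no bond of $\mathcal L$; $J(G,\mathcal L)=J_0(G,\mathcal L)/e_0$. For $X\subseteq E(G)$, $\pi_X$ is the partition of $V(G)$ into vertex sets of the components of $(V(G),X)$; $\mathrm{Ext}(\pi)$ is the set of edges of $G$ whose endpoints lie in different parts of $\pi$.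 A partition $\pi$ (each part inducing a connected subgraph) is cobalanced if every bond of $G$ contained in $\mathrm{Ext}(\pi)$ lies in $\mathcal L$, and un-cobalanced otherwise. *)

(* Defs.v *)
From mathcomp Require Import all_boot all_order all_algebra.

Set Implicit Arguments.
Unset Strict Implicit.
Unset Printing Implicit Defensive.

(* A loop is an edge with one end and a link an edge with two ends; the edge
   type is arbitrary, so parallel edges are allowed. *)
Record mgraph := MGraph {
  vertex : finType;
  edge : finType;
  ends : edge -> {set vertex};
  _ : forall e, 0 < #|ends e| <= 2
}.

Section Graph.
Variable G : mgraph.
Local Notation V := (vertex G).
Local Notation E := (edge G).
Implicit Types (X S : {set V}) (A B D : {set E}) (P : {set {set V}}).
Implicit Types (L : {set {set E}}).

Definition adj A : rel V := fun x y => [exists e in A, ends e == [set x; y]].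

(* The vertex sets of the components of the spanning subgraph (V(G), A);
   this is the partition pi_A. *)
Definition comps A : {set {set V}} :=
  equivalence_partition (connect (adj A)) [set: V].

Definition induced S : {set E} := [set e | ends e \subset S].

Definition connected_in S : bool :=
  (S != set0) && [forall x in S, forall y in S, connect (adj (induced S)) x y].

Definition joined S1 S2 : bool :=
  [exists x in S1, exists y in S2, adj [set: E] x y].

Definition delta X : {set E} :=
  [set e | (#|ends e| == 2) && (#|ends e :&: X| == 1)].

Definition edge_cut D : bool := [exists X, D == delta X].

Definition bond B : bool := minset [pred D | edge_cut D && (D != set0)] B.

(* Tripartitions {X1, X2, X3} of the vertex set of one component. *)
Definition tripartition P : bool :=
  [&& #|P| == 3,
      [exists C in comps [set: E], partition P C],
      [forall X in P, connected_in X]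
    & [forall X in P, forall Y in P, (X != Y) ==> joined X Y]].

Definition tribond D : bool :=
  [exists P, tripartition P && (D == \bigcup_(X in P) delta X)].

Definition modular_pair B1 B2 : bool :=
  [&& bond B1, bond B2
    & #|comps (~: (B1 :|: B2))| == #|comps [set: E]| + 2].

Definition dibond D : bool :=
  [exists B1, exists B2, modular_pair B1 B2 && (D == B1 :|: B2)]
  && ~~ tribond D.

Definition linear_class L : Prop :=
  (forall B, B \in L -> bond B) /\
  (forall P, tripartition P -> #|[set X in P | delta X \in L]| <> 2).

Definition trivial_class L : Prop := forall B, bond B -> B \in L.

Definition Ext P : {set E} :=
  [set e | [exists x in ends e, exists y in ends e,
              pblock P x != pblock P y]].

Definition cobalanced L P : Prop :=
  forall B, bond B -> B \subset Ext P -> B \in L.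

(* The prescribed cocircuits of J_0(G, L). The ground set E(G) + e0 is
   [option E], with [None] for e0. *)
Definition J0_cocircuits L : {set {set option E}} :=
  [set Some @: B | B : {set E} in L]
  :|: [set None |: (Some @: B) | B : {set E} & bond B && (B \notin L)]
  :|: [set Some @: D | D : {set E} &
         (tribond D || dibond D) && ~~ [exists B in L, B \subset D]].

End Graph.

Record matroid (T : finType) := Matroid {
  indep : pred {set T};
  indep0 : indep set0;
  indepS : forall I J : {set T}, I \subset J -> indep J -> indep I;
  indep_aug : forall I J : {set T}, indep I -> indep J -> #|I| < #|J| ->
    exists2 x, x \in J :\: I & indep (x |: I)
}.

Section Matroid.
Variables (T : finType) (M : matroid T).
Implicit Types (I B D X : {set T}).

Definition base B : bool := maxset (indep M) B.

Definition rank X : nat := \max_(I : {set T} | indep M I && (I \subset X)) #|I|.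

(* The bases of the dual matroid are the complements of the bases of M. *)
Definition coindep D : bool := [exists B, base B && (D \subset ~: B)].

Definition cocircuit D : bool := minset [pred C | ~~ coindep C] D.

End Matroid.

Section Contraction.
Variables (T : finType) (M : matroid (option T)).
Implicit Types (I J : {set T}).

Definition contract_indep I : bool :=
  indep M (if indep M [set None] then None |: (Some @: I) else Some @: I).

Let Some_inj : injective (@Some T). Proof. by move=> x y []. Qed.

Let None_notin I : None \notin Some @: I.
Proof. by apply/imsetP => -[]. Qed.

Fact contract_indep0 : contract_indep set0.
Proof.
rewrite /contract_indep imset0; case: ifP => // h; first by rewrite setU0.
exact: indep0.
Qed.

Fact contract_indepS I J :
  I \subset J -> contract_indep J -> contract_indep I.
Proof.
move=> sIJ; have sIJ' : Some @: I \subset Some @: J by apply: imsetS.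
by rewrite /contract_indep; case: ifP => _; apply: indepS; rewrite ?setUS.
Qed.

Fact contract_indep_aug I J :
    contract_indep I -> contract_indep J -> #|I| < #|J| ->
  exists2 x, x \in J :\: I & contract_indep (x |: I).
Proof.
rewrite /contract_indep; case: ifP => _ iI iJ ltIJ.
  have [|[x|]] := indep_aug iI iJ.
  - by rewrite !cardsU1 !None_notin !card_imset // ltn_add2l.
  - rewrite !inE /= !(mem_imset _ _ Some_inj) => xJ ix.
    by exists x; rewrite ?inE // imsetU1 setUCA.
  - by rewrite !inE.
have [|[x|]] := indep_aug iI iJ; first by rewrite !card_imset.
- rewrite !inE !(mem_imset _ _ Some_inj) => xJ ix.
  by exists x; rewrite ?inE // imsetU1.
- by rewrite !inE (negPf (None_notin J)) andbF.
Qed.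

(* The contraction M / None, as a matroid on T; if None is a loop of M, then
   contracting it is the same as deleting it. *)
Definition contract : matroid T :=
  Matroid contract_indep0 contract_indepS contract_indep_aug.

End Contraction.

(* J0 is the matroid J_0(G, L): a matroid is determined by its cocircuits.
   The join matroid J(G, L) is then [contract J0]. *)
Definition is_J0 (G : mgraph) (L : {set {set edge G}})
    (J0 : matroid (option (edge G))) : Prop :=
  forall D, cocircuit J0 D = (D \in J0_cocircuits L).

(* Main.v *)
Require Import Defs.
From mathcomp Require Import all_boot all_order all_algebra.
From mathcomp Require Import zify.

Set Implicit Arguments.
Unset Strict Implicit.
Unset Printing Implicit Defensive.

(** Every cocircuit of J_0 restricts on E(G) to a union of bonds, and every
    bond is such a restriction, so deleting e_0 from J_0 leaves the cycle matroid
    of G and J_0 has rank |V(G)| - |pi_X| on X.  Contracting e_0 changes this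
    by r(X + e_0) - r(X) - 1, and e_0 lies outside the closure of X exactly
    when some bond outside L avoids X, that is, when pi_X is un-cobalanced. *)

(** * Independence, rank and cocircuits of a matroid *)

Section MatroidRank.
Variables (T : finType) (M : matroid T).
Implicit Types (I J B D X Y : {set T}).

Lemma indep_leq_rank I X : indep M I -> I \subset X -> #|I| <= rank M X.
Proof. by move=> iI sIX; apply: leq_bigmax_cond; rewrite iI. Qed.

Lemma rank_witness X :
  exists I, [/\ indep M I, I \subset X & #|I| = rank M X].
Proof.
have [|I /andP[iI sIX] eI] :=
    @eq_bigmax_cond _ [pred I | indep M I && (I \subset X)] (fun I => #|I|).
  by apply/card_gt0P; exists set0; rewrite inE indep0 sub0set.
by exists I; split=> //; rewrite -eI.
Qed.

(** Augment [I] repeatedly from [J]. The bound [K \subset I :|: J] records that every new element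
    comes from [J]; the cocircuit argument below relies on it. *)
Lemma indep_extend I J : indep M I -> indep M J -> #|I| <= #|J| ->
  exists K, [/\ indep M K, I \subset K, K \subset I :|: J & #|K| = #|J|].
Proof.
have [n] := ubnP (#|J| - #|I|).
elim: n I => // n IHn I ltn iI iJ leIJ.
have [eqIJ|ltIJ] := eqVneq #|I| #|J|.
  by exists I; rewrite subxx subsetUl.
have {}ltIJ : #|I| < #|J| by rewrite ltn_neqAle ltIJ.
have [x /setDP[xJ xI] ixI] := indep_aug iI iJ ltIJ.
have cx : #|x |: I| = #|I|.+1 by rewrite cardsU1 xI.
have [||K [iK sIK sKJ cK]] := IHn (x |: I) _ ixI iJ; rewrite ?cx; try lia.
exists K; split=> //; first exact: subset_trans (subsetUr _ _) sIK.
apply: subset_trans sKJ _; rewrite -setUA subUset subxx andbT sub1set.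
by rewrite inE xJ orbT.
Qed.

Lemma indep_extend_rank I X : indep M I -> I \subset X ->
  exists K, [/\ indep M K, I \subset K, K \subset X & #|K| = rank M X].
Proof.
move=> iI sIX; have [J [iJ sJX cJ]] := rank_witness X.
have [|K [iK sIK sK cK]] := indep_extend iI iJ.
  by rewrite cJ indep_leq_rank.
exists K; split=> //; last by rewrite cK.
by apply: subset_trans sK _; rewrite subUset sIX.
Qed.

Lemma baseE B : base M B = indep M B && (#|B| == rank M setT).
Proof.
apply/maxsetP/andP => [[iB maxB] | [iB /eqP cB]].
  have [K [iK sBK _ cK]] := indep_extend_rank iB (subsetT B).
  by rewrite -cK (maxB K iK sBK) iB eqxx.
split=> // J iJ sBJ; apply/esym/eqP; rewrite eqEcard sBJ cB.
exact: indep_leq_rank iJ (subsetT J).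
Qed.

Lemma rankS X Y : X \subset Y -> rank M X <= rank M Y.
Proof.
move=> sXY; have [I [iI sIX <-]] := rank_witness X.
exact: indep_leq_rank iI (subset_trans sIX sXY).
Qed.

Lemma rank_setU1_le x X : rank M (x |: X) <= (rank M X).+1.
Proof.
have [I [iI sI <-]] := rank_witness (x |: X).
have iIx : indep M (I :\ x) by apply: indepS iI; apply: subD1set.
have sIx : I :\ x \subset X by rewrite subDset.
by have := indep_leq_rank iIx sIx; have := cardsD1 x I; lia.
Qed.

(** Otherwise some base would avoid [D]. By minimality of [D] a base [B] avoids [D :\ x]; extend a
    basis [I] of [X] by elements of [B] to a base [K]. Since [D] misses [X], an element of [D] in
    [K] comes from [B], hence is [x]; but then [x |: I] is independent and larger than the rank of
    [x |: X]. *)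
Lemma cocircuit_rank_lt D x X : cocircuit M D -> x \in D -> [disjoint D & X] ->
  rank M X < rank M (x |: X).
Proof.
move=> /minsetP[/= ncD minD] xD dDX; rewrite ltnNge; apply: contra ncD => leX.
have [I [iI sIX cI]] := rank_witness X.
have /existsP[B /andP[bB sDB]] : coindep M (D :\ x).
  apply: contraT => ncDx; have := minD _ ncDx (subD1set _ _).
  by move/setP/(_ x); rewrite !inE eqxx xD.
move: bB; rewrite baseE => /andP[iB /eqP cB].
have leIB : #|I| <= #|B| by rewrite cB indep_leq_rank ?subsetT.
have [K [iK sIK sK cK]] := indep_extend iI iB leIB.
have xX : x \notin X by rewrite (disjointFr dDX xD).
apply/existsP; exists K; rewrite baseE iK cK cB eqxx /=.
apply/subsetP => y yD; rewrite inE; apply/negP => yK.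
have yI : y \notin I.
  by apply/negP => /(subsetP sIX); rewrite (disjointFr dDX yD).
have yB : y \in B by have := subsetP sK y yK; rewrite inE (negPf yI).
have [eyx|nyx] := eqVneq y x; last first.
  have : y \in ~: B by apply: (subsetP sDB); rewrite !inE nyx.
  by rewrite inE yB.
have iyI : indep M (y |: I).
  by apply: indepS iK; rewrite subUset sub1set yK.
have := indep_leq_rank iyI (setUS [set y] sIX).
by rewrite eyx in yI *; rewrite cardsU1 yI cI add1n ltnNge leX.
Qed.

(* The cocircuit is the complement of the hyperplane spanned by B - x, for
   a base B containing x and a basis of X. *)
Lemma rank_lt_cocircuit x X : rank M X < rank M (x |: X) ->
  exists D, [/\ cocircuit M D, x \in D & [disjoint D & X]].
Proof.
move=> ltX; have [I [iI sIX cI]] := rank_witness X.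
have [K [iK sIK sK cK]] :=
  indep_extend_rank iI (subset_trans sIX (subsetUr [set x] X)).
have xK : x \in K.
  apply: contraLR ltX => xK; rewrite -leqNgt -cK.
  apply: indep_leq_rank iK _; move: sK.
  by rewrite -subDset (setDidPl _) // disjoint_sym disjoints1.
have [B [iB sKB _ cB]] := indep_extend_rank iK (subsetT K).
have xB := subsetP sKB x xK.
have sIB : I \subset B :\ x.
  rewrite subsetD1 (subset_trans sIK sKB) /=; apply/negP => xI.
  by move: ltX; rewrite (setUidPr _) ?ltnn // sub1set (subsetP sIX).
have cBx : #|B| = #|B :\ x|.+1 by rewrite (cardsD1 x B) xB.
pose D := [set y | (y \notin B :\ x) && indep M (y |: B :\ x)].
exists D; split; last 2 first.
- by rewrite !inE eqxx setD1K.
- rewrite disjoint_subset; apply/subsetP => y; rewrite inE => /andP[yB iy].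
  rewrite !inE; apply/negP => yX.
  have iyI : indep M (y |: I) by apply: indepS iy; apply: setUS.
  have yI : y \notin I by apply: contra yB; apply: subsetP.
  have := @indep_leq_rank (y |: I) X iyI.
  by rewrite subUset sub1set yX sIX cardsU1 yI cI ltnn => /(_ isT).
apply/minsetP; split=> [/=|D' /= ncD' sD'D].
  (* Every base meets [D]: an element of [B'] that augments [B :\ x] lies in [D]. *)
  apply/existsP => -[B' /andP[]]; rewrite baseE => /andP[iB' /eqP cB'] sDB'.
  have iBx : indep M (B :\ x) by apply: indepS iB; apply: subD1set.
  have [|y /setDP[yB' yB] iy] := indep_aug iBx iB'; first by rewrite cB' -cB cBx.
  have yD : y \in D by rewrite inE yB iy.
  by have := subsetP sDB' y yD; rewrite inE yB'.
apply/eqP; rewrite eqEsubset sD'D /=; apply/subsetP => y yD.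
(* If [D'] omits some [y] in [D], then [y |: B :\ x] is a base avoiding [D'], so [D'] is
   coindependent. *)
apply: contraR ncD' => yD'; move: yD; rewrite inE => /andP[yB iy].
apply/existsP; exists (y |: B :\ x); rewrite baseE iy cardsU1 yB -cB cBx eqxx /=.
apply/subsetP => z zD'; have := subsetP sD'D z zD'.
rewrite inE => /andP[zB _]; rewrite in_setC in_setU1 negb_or zB andbT.
by apply: contraNneq yD' => <-.
Qed.

Lemma rank_setU1_in x X :
  (exists D, [/\ cocircuit M D, x \in D & [disjoint D & X]]) ->
  rank M (x |: X) = (rank M X).+1.
Proof.
move=> [D [cD xD dDX]]; apply/eqP; rewrite eqn_leq rank_setU1_le.
exact: cocircuit_rank_lt cD xD dDX.
Qed.

Lemma rank_setU1_notin x X :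
  ~ (exists D, [/\ cocircuit M D, x \in D & [disjoint D & X]]) ->
  rank M (x |: X) = rank M X.
Proof.
move=> nD; apply/eqP; rewrite eqn_leq (rankS (subsetUr _ _)) andbT leqNgt.
by apply/negP => /rank_lt_cocircuit.
Qed.

Lemma rank0 : rank M set0 = 0.
Proof.
have [I [_ sI <-]] := rank_witness set0.
by move: sI; rewrite subset0 => /eqP ->; rewrite cards0.
Qed.

(** An element of a cocircuit is not a loop, by the rank increase over the empty set. This puts the
    contraction of [None] in its non-loop case. *)
Lemma cocircuit_indep1 D x : cocircuit M D -> x \in D -> indep M [set x].
Proof.
move=> cD xD; have := @cocircuit_rank_lt D x set0 cD xD.
rewrite rank0 setU0 -setI_eq0 setI0 eqxx => /(_ isT).
have [I [iI sI <-]] := rank_witness [set x].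
by move: sI; rewrite subset1 => /orP[/eqP <-|/eqP->]; rewrite ?cards0.
Qed.

End MatroidRank.

(** * Rank in the contraction of the extra element *)

Lemma Some_inj (T : Type) : injective (@Some T).
Proof. by move=> x y []. Qed.

Lemma None_notin_imset (T : finType) (X : {set T}) : None \notin Some @: X.
Proof. by apply/imsetP => -[]. Qed.

Lemma mem_Some_imset (T : finType) (X : {set T}) x :
  (Some x \in Some @: X) = (x \in X).
Proof. exact: mem_imset (@Some_inj T). Qed.

(** As [None] is not a loop, a maximum independent subset of [None |: Some @: X] can be grown from
    [[set None]]; removing [None] from such sets matches them with the independent subsets of [X] in
    the contraction. *)
Lemma rank_contract (T : finType) (M : matroid (option T)) (X : {set T}) :
  indep M [set None] ->
  rank M (None |: Some @: X) = (rank (contract M) X).+1.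
Proof.
move=> iN; apply/eqP; rewrite eqn_leq; apply/andP; split.
  have [|K [iK sNK sK <-]] :=
    @indep_extend_rank _ M [set None] (None |: Some @: X) iN.
    exact: subsetUl.
  rewrite sub1set in sNK.
  have eK : K = None |: Some @: (Some @^-1: K).
    apply/setP => -[x|]; rewrite !inE /= ?sNK //.
    by rewrite mem_Some_imset inE.
  rewrite eK cardsU1 None_notin_imset card_imset; last exact: Some_inj.
  rewrite add1n ltnS indep_leq_rank //=.
    by rewrite /contract_indep iN -eK.
  apply/subsetP => x; rewrite inE => /(subsetP sK).
  by rewrite inE mem_Some_imset => /orP[/set1P|].
have [I [iI sIX <-]] := rank_witness (contract M) X.
move: iI; rewrite /= /contract_indep iN => iI.
have := indep_leq_rank iI (setUS [set None] (imsetS Some sIX)).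
by rewrite cardsU1 None_notin_imset card_imset //; apply: Some_inj.
Qed.

(** * Edge cuts, bonds and the partition into components *)

Section GraphCuts.
Variable G : mgraph.
Local Notation V := (vertex G).
Local Notation E := (edge G).
Implicit Types (S : {set V}) (A B D : {set E}) (x y u v : V) (e : E).

Lemma ends_pair e : exists x y, ends e = [set x; y].
Proof.
have : 0 < #|ends e| <= 2 by case: (G) e.
case/andP=> h0; rewrite leq_eqVlt ltnS => /orP[/cards2P[x [y [_ ->]]]|h1].
  by exists x, y.
have /eqP/cards1P[x ->] : #|ends e| = 1 by lia.
by exists x, x; rewrite setUid.
Qed.

(** Loops are the case [x = y], where both sides are false, so later arguments treat loops and links
    alike. *)
Lemma mem_delta e S x y : ends e = [set x; y] ->
  (e \in delta S) = ((x \in S) != (y \in S)).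
Proof.
move=> ee; rewrite inE ee cards2.
have [<-|nxy] /= := eqVneq x y; first by rewrite eqxx.
have -> : #|[set x; y] :&: S| = (x \in S) + (y \in S).
  rewrite setIUl cardsU -setIIl (_ : [set x] :&: [set y] = set0).
    rewrite set0I cards0 subn0.
    have card1I z : #|[set z] :&: S| = (z \in S).
      case: (boolP (z \in S)) => zS; first by rewrite (setIidPl _) ?sub1set ?cards1.
      by apply/eqP; rewrite cards_eq0 setI_eq0 disjoints1.
    by rewrite !card1I.
  by apply/eqP; rewrite setI_eq0 disjoints1 inE.
by case: (x \in S); case: (y \in S).
Qed.

Definition symdiff (T : finType) (A B : {set T}) : {set T} :=
  [set x | (x \in A) != (x \in B)].

Lemma delta_symdiff S1 S2 :
  delta (symdiff S1 S2) = symdiff (delta S1) (delta S2).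
Proof.
apply/setP => e; have [x [y ee]] := ends_pair e.
rewrite [RHS]inE !(mem_delta _ ee) !inE.
by case: (x \in S1); case: (y \in S1); case: (x \in S2); case: (y \in S2).
Qed.

(** Take [B] minimal among the cuts that contain [e]. A nonempty cut [D] inside [B] that contains
    [e] equals [B]; one that misses [e] would make [symdiff B D] a strictly smaller cut containing
    [e]. *)
Lemma edge_cut_bond e S : e \in delta S ->
  exists B, [/\ bond B, e \in B & B \subset delta S].
Proof.
move=> eS.
have [B /minsetP[/andP[/= cB eB] minB] sB] :
    {B | minset [pred D : {set E} | edge_cut D && (e \in D)] B
        & B \subset delta S}.
  apply: minset_exists; rewrite /= eS andbT; apply/existsP; by exists S.
exists B; split=> //; apply/minsetP; split=> /= [|D /andP[cD nD] sDB].
  by rewrite cB; apply/set0Pn; exists e.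
case: (boolP (e \in D)) => eD; first by apply: minB; rewrite //= cD eD.
move: cB cD => /existsP[S1 /eqP e1] /existsP[S2 /eqP e2].
have sd : symdiff B D \subset B.
  apply/subsetP => f; rewrite inE; case: (boolP (f \in B)) => // fB.
  by case: (boolP (f \in D)) => // /(subsetP sDB); rewrite (negPf fB).
have eqd : symdiff B D = B.
  apply: minB => //=; rewrite inE eB (negPf eD) andbT.
  by apply/existsP; exists (symdiff S1 S2); rewrite delta_symdiff -e1 -e2.
have [f fD] := set0Pn _ nD.
by have /setP/(_ f) := eqd; rewrite inE fD (subsetP sDB f fD).
Qed.

Lemma adj_sym A : symmetric (adj A).
Proof. by move=> x y; rewrite /adj setUC. Qed.

Lemma adj_connect_sym A : connect_sym (adj A).
Proof. exact/sym_connect_sym/adj_sym. Qed.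

Lemma connect_adj_equiv A :
  {in [set: V] & &, equivalence_rel (connect (adj A))}.
Proof.
move=> x y z _ _ _; split=> [|cxy]; first exact: connect0.
by rewrite (same_connect (adj_connect_sym A) cxy).
Qed.

Lemma pblock_comps A x y :
  (pblock (comps A) x == pblock (comps A) y) = connect (adj A) x y.
Proof.
have /and3P[/eqP cov tI _] : partition (comps A) [set: V]
  := equivalence_partitionP (@connect_adj_equiv A).
rewrite eq_pblock // ?cov ?inE //.
by rewrite (pblock_equivalence_partition (@connect_adj_equiv A)).
Qed.

Lemma mem_Ext_comps A e x y : ends e = [set x; y] ->
  (e \in Ext (comps A)) = ~~ connect (adj A) x y.
Proof.
move=> ee; rewrite inE; apply/existsP/idP => [[u /andP[]]|nxy].
  rewrite ee => /set2P hu /existsP[v /andP[/set2P hv]]; rewrite pblock_comps.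
  case: hu hv => -> [] ->; rewrite ?connect0 //.
  by rewrite adj_connect_sym.
exists x; rewrite ee set21; apply/existsP; exists y.
by rewrite set22 pblock_comps.
Qed.

Lemma disjoint_delta_connect A S x y :
  [disjoint delta S & A] -> connect (adj A) x y -> (x \in S) = (y \in S).
Proof.
move=> dSA; apply: (@closed_connect _ (adj A) (mem S)) => u v /existsP[e /andP[eA /eqP ee]].
apply/eqP; apply: contraTT eA => nuv.
by rewrite (disjointFr dSA) // (mem_delta _ ee).
Qed.

Lemma adj_Ext A e : e \in A -> e \notin Ext (comps A).
Proof.
move=> eA; have [x [y ee]] := ends_pair e.
rewrite (mem_Ext_comps _ ee) negbK; apply: connect1.
by apply/existsP; exists e; rewrite eA ee eqxx.
Qed.

(** If the cut misses [A], then [S] is a union of parts of [comps A], so its crossing edges join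
    different parts. This trades the containment in [cobalanced] for the disjointness in the
    cocircuit criterion. *)
Lemma delta_sub_Ext A S :
  (delta S \subset Ext (comps A)) = [disjoint delta S & A].
Proof.
apply/idP/idP => [sSE|dSA].
  rewrite disjoint_subset; apply/subsetP => e /(subsetP sSE) eE.
  by rewrite inE; apply: contraL eE => /adj_Ext.
apply/subsetP => e eS; have [x [y ee]] := ends_pair e.
rewrite (mem_Ext_comps _ ee); move: eS; rewrite (mem_delta _ ee).
by apply: contra => /(disjoint_delta_connect dSA) ->.
Qed.

(** The cut around the component of one end of [e] contains [e] and no edge of [A]; any bond through
    [e] inside that cut works. *)
Lemma Ext_comps_bond A e : e \in Ext (comps A) ->
  exists B, [/\ bond B, e \in B & [disjoint B & A]].
Proof.
have [x [y ee]] := ends_pair e; rewrite (mem_Ext_comps _ ee) => nxy.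
pose S := [set u | connect (adj A) x u].
have eS : e \in delta S by rewrite (mem_delta _ ee) !inE connect0 (negPf nxy).
have [B [bB eB sB]] := edge_cut_bond eS.
exists B; split=> //; apply: disjointWl sB _; rewrite disjoint_subset.
apply/subsetP => f fS; rewrite inE; apply/negP => fA.
have [u [v ff]] := ends_pair f; move: fS; rewrite (mem_delta _ ff) !inE.
have auv : connect (adj A) u v.
  by apply: connect1; apply/existsP; exists f; rewrite fA ff eqxx.
by rewrite (same_connect_r (adj_connect_sym A) auv) eqxx.
Qed.

Lemma bond_edge_cut B : bond B -> exists S, B = delta S.
Proof. by move=> /minsetP[/andP[/existsP[S /eqP ->] _] _]; exists S. Qed.

(** * Effect of one new edge on the components *)

Lemma compsE A : comps A = [set [set y | connect (adj A) x y] | x : V].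
Proof.
apply/setP => C; apply/imsetP/imsetP => -[x _ ->]; exists x; rewrite ?inE //;
  by apply/setP => y; rewrite !inE.
Qed.

(** A walk may be assumed to cross [e] at most once, in either direction. *)
Lemma connect_setU1 A e x y u v : ends e = [set x; y] ->
  connect (adj (e |: A)) u v =
  [|| connect (adj A) u v, connect (adj A) u x && connect (adj A) y v
    | connect (adj A) u y && connect (adj A) x v].
Proof.
move=> ee; have sub : subrel (connect (adj A)) (connect (adj (e |: A))).
  apply: connect_sub => a b /existsP[f /andP[fA h]]; apply: connect1.
  by apply/existsP; exists f; rewrite inE fA orbT.
have exy : connect (adj (e |: A)) x y.
  by apply: connect1; apply/existsP; exists e; rewrite setU11 ee eqxx.
apply/idP/idP; last first.
  case/or3P => [/sub//|/andP[/sub h1 /sub h2]|/andP[/sub h1 /sub h2]].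
    exact: connect_trans h1 (connect_trans exy h2).
  apply: connect_trans h1 (connect_trans _ h2).
  by rewrite adj_connect_sym.
(* Instead of shortening walks, the right-hand side is read as a set of vertices [w] that contains
   [u] and is closed under adjacency in [e |: A]. *)
pose R := [set w | [|| connect (adj A) u w,
      connect (adj A) u x && connect (adj A) y w
    | connect (adj A) u y && connect (adj A) x w]].
have clR : closed (adj (e |: A)) (mem R).
  apply: intro_closed; first exact: adj_connect_sym.
  move=> a b /existsP[f /andP[]]; rewrite in_setU1 => /orP[/eqP->|fA] /eqP ff.
    (* The pair is matched in either order; [a = b] occurs only when [e] is a loop. *)
    have {ff} : (a = x /\ b = y) \/ (a = y /\ b = x) \/ (a = b).
      have : a \in ends e by rewrite ff set21.
      have : b \in ends e by rewrite ff set22.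
      have : x \in [set a; b] by rewrite -ff ee set21.
      have : y \in [set a; b] by rewrite -ff ee set22.
      rewrite ee => /set2P h1 /set2P h2 /set2P h3 /set2P h4.
      case: h3 h4 => -> [] ->; auto.
    case=> [[-> ->]|[[-> ->]|->]] //; rewrite !inE ?connect0 ?andbT.
      by case/or3P=> [->|/andP[->]|->]; rewrite ?orbT.
    by case/or3P=> [->|->|/andP[->]]; rewrite ?orbT.
  have ab : connect (adj A) a b.
    by apply: connect1; apply/existsP; exists f; rewrite fA ff eqxx.
  by rewrite !inE !(same_connect_r (adj_connect_sym A) ab).
by move=> /(closed_connect clR); rewrite !inE connect0 /= => <-.
Qed.

Lemma comps_setU1_same A e : e \notin Ext (comps A) -> comps (e |: A) = comps A.
Proof.
have [x [y ee]] := ends_pair e; rewrite (mem_Ext_comps _ ee) negbK => cxy.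
rewrite !compsE; apply: eq_imset => u; apply/setP => v; rewrite !inE.
rewrite (connect_setU1 _ _ _ ee) -(same_connect_r (adj_connect_sym A) cxy).
rewrite -(same_connect (adj_connect_sym A) cxy) orbb.
by apply/orb_idr => /andP[]; apply: connect_trans.
Qed.

(** The new edge merges the two distinct classes of its ends and leaves the other classes
    unchanged. *)
Lemma card_comps_setU1 A e : e \in Ext (comps A) ->
  #|comps A| = #|comps (e |: A)|.+1.
Proof.
have [x [y ee]] := ends_pair e; rewrite (mem_Ext_comps _ ee) => nxy.
have sym := adj_connect_sym A.
pose c u := [set v | connect (adj A) u v].
have ceq u v : (c u == c v) = connect (adj A) u v.
  apply/eqP/idP => [/setP/(_ v)|h]; first by rewrite !inE connect0.
  by apply/setP => w; rewrite !inE (same_connect sym h).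
have cin u : c u \in comps A by rewrite compsE; apply: imset_f.
have eqc : comps (e |: A) = (c x :|: c y) |: (comps A :\ c x :\ c y).
  have cE u : [set v | connect (adj (e |: A)) u v] =
      if connect (adj A) x u || connect (adj A) y u then c x :|: c y else c u.
    apply/setP => v; rewrite inE (connect_setU1 _ _ _ ee).
    rewrite [connect _ u x]sym [connect _ u y]sym.
    case: (boolP (connect (adj A) x u)) => xu /=.
      have -> : connect (adj A) y u = false.
        by apply: contraNF nxy => yu; rewrite (connect_trans xu) // sym.
      by rewrite orbF !inE (same_connect sym xu).
    case: (boolP (connect (adj A) y u)) => yu /=; last by rewrite orbF inE.
    by rewrite !inE (same_connect sym yu) orbC.
  apply/setP => C; rewrite compsE; apply/imsetP/idP => [[u _ ->]|].
    rewrite cE; case: ifP => [_|/norP[xu yu]]; first exact: setU11.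
    rewrite in_setU1 !in_setD1 cin andbT; apply/orP; right.
    by rewrite eq_sym ceq yu eq_sym ceq.
  rewrite in_setU1 !in_setD1 => /orP[/eqP->|/and3P[]].
    by exists x; rewrite ?inE // cE connect0.
  rewrite compsE => Cy Cx /imsetP[u _ eC]; exists u; rewrite ?inE // cE.
  rewrite -!ceq [c x == _]eq_sym [c y == _]eq_sym -[c u]eC.
  by rewrite (negPf Cx) (negPf Cy) eC.
(* The merged class must be new, or inserting it would not add one to the count: a class containing
   both [x] and [y] would connect them in [A]. *)
have nU : c x :|: c y \notin comps A.
  rewrite compsE; apply/imsetP => -[u _ /setP eU].
  have := eU x; have := eU y; rewrite !inE !connect0 orbT /= => uy ux.
  by move: nxy; rewrite -(same_connect sym (esym ux)) -uy.
rewrite eqc cardsU1 !in_setD1 (negPf nU) !andbF.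
rewrite (cardsD1 (c x)) cin (cardsD1 (c y)) in_setD1 cin andbT.
by rewrite [c y == _]eq_sym ceq nxy.
Qed.

Lemma comps0 : #|comps (set0 : {set E})| = #|V|.
Proof.
rewrite compsE card_imset // => u v /setP/(_ v); rewrite !inE connect0.
have ncl : closed (adj (set0 : {set E})) (pred1 u).
  by move=> a b /existsP[f]; rewrite inE.
by move/(closed_connect ncl); rewrite !inE eqxx => /esym/eqP.
Qed.

End GraphCuts.

(** * Closure and rank in the matroid with the prescribed cocircuits *)

Section JoinMatroid.
Variables (G : mgraph) (L : {set {set edge G}}).
Hypothesis LB : forall B, B \in L -> bond B.
Variable J0 : matroid (option (edge G)).
Hypothesis HJ0 : is_J0 L J0.
Local Notation E := (edge G).
Implicit Types (A B X : {set E}).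

(** Away from [None], each prescribed cocircuit is a union of cuts: a bond, the three cuts of a
    tripartition, or two bonds. Asking for a cut rather than a bond lets a part of the tripartition
    serve directly. *)
Lemma cocircuit_edge_cut D e : cocircuit J0 D -> Some e \in D ->
  exists2 S, e \in delta S & Some @: delta S \subset D.
Proof.
have bcut B : bond B -> e \in B ->
    exists2 S, e \in delta S & delta S \subset B.
  by move=> /bond_edge_cut[S ->]; exists S.
rewrite HJ0 => /setUP[/setUP[]|] /imsetP[B].
- move=> /LB bB ->; rewrite mem_Some_imset => /(bcut _ bB)[S eS sS].
  by exists S => //; apply: imsetS.
- rewrite inE => /andP[bB _] ->; rewrite inE mem_Some_imset /=.
  rewrite inE /= => /(bcut _ bB)[S eS sS].
  by exists S => //; apply: subset_trans (imsetS _ sS) (subsetUr _ _).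
rewrite inE => /andP[h _] ->; rewrite mem_Some_imset => eB.
suff [S eS sS] : exists2 S, e \in delta S & delta S \subset B.
  by exists S => //; apply: imsetS.
case/orP: h => [/existsP[P /andP[_ /eqP eqB]]|/andP[/existsP[B1 /existsP[B2]]]].
  move: eB; rewrite eqB => /bigcupP[S SP eS]; exists S => //.
  exact: bigcup_sup SP.
move=> /andP[/and3P[b1 b2 _] /eqP eqB] _; move: eB; rewrite eqB.
case/setUP => [/(bcut _ b1)|/(bcut _ b2)] [S eS sS]; exists S => //.
  exact: subset_trans sS (subsetUl _ _).
exact: subset_trans sS (subsetUr _ _).
Qed.

Lemma disjoint_Some A X : [disjoint Some @: A & Some @: X] = [disjoint A & X].
Proof.
rewrite -!setI_eq0 -imsetI; last by move=> x y _ _ [].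
by rewrite imset_eq0.
Qed.

Lemma disjoint_NoneU A X :
  [disjoint None |: Some @: A & Some @: X] = [disjoint A & X].
Proof.
rewrite !disjoints_subset subUset sub1set inE None_notin_imset.
by rewrite -disjoints_subset disjoint_Some disjoints_subset.
Qed.

(** This identifies the edges outside the closure of [X] with those joining different components. A
    cocircuit through [e] avoiding [X] contains a cut doing the same; conversely a bond through [e]
    avoiding [X] gives a cocircuit, alone or with [None], which never lies in [Some @: X]. *)
Lemma Ext_cocircuit X e :
  (exists D, [/\ cocircuit J0 D, Some e \in D & [disjoint D & Some @: X]]) <->
  e \in Ext (comps X).
Proof.
split=> [[D [cD eD dD]]|/Ext_comps_bond[B [bB eB dB]]].
  have [S eS sS] := cocircuit_edge_cut cD eD.
  have := disjointWl sS dD; rewrite disjoint_Some -delta_sub_Ext.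
  by move/subsetP; apply.
case: (boolP (B \in L)) => BL.
  exists (Some @: B); rewrite mem_Some_imset disjoint_Some eB dB; split=> //.
  by rewrite HJ0 !inE imset_f.
exists (None |: Some @: B); rewrite disjoint_NoneU dB inE mem_Some_imset eB orbT.
split=> //; rewrite HJ0 !inE; apply/orP; left; apply/orP; right.
by apply/imsetP; exists B; rewrite // inE bB.
Qed.

(** Only the cocircuits built from bonds outside [L] contain [None]. The right-hand side is the
    failure of [cobalanced] with an explicit witness. *)
Lemma None_cocircuit X :
  (exists D, [/\ cocircuit J0 D, None \in D & [disjoint D & Some @: X]]) <->
  (exists B, [/\ bond B, B \subset Ext (comps X) & B \notin L]).
Proof.
split=> [[D []]|[B [bB sB BL]]].
  rewrite HJ0 => /setUP[/setUP[]|] /imsetP[B].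
  - by move=> _ ->; rewrite (negPf (None_notin_imset _)).
  - rewrite inE => /andP[bB BL] -> _; rewrite disjoint_NoneU => dB.
    exists B; split=> //; have [S eB] := bond_edge_cut bB.
    by rewrite eB delta_sub_Ext -eB.
  - by move=> _ ->; rewrite (negPf (None_notin_imset _)).
have [S eB] := bond_edge_cut bB.
exists (None |: Some @: B); rewrite disjoint_NoneU setU11; split=> //.
  rewrite HJ0 !inE; apply/orP; left; apply/orP; right.
  by apply/imsetP; exists B; rewrite // inE bB.
by rewrite eB -delta_sub_Ext -eB.
Qed.

(** Adding an edge raises the rank by one exactly when it merges two components, so the sum stays at
    its value for the empty set, the number of vertices. *)
Lemma rank_Some X : rank J0 (Some @: X) + #|comps X| = #|vertex G|.
Proof.
have [n] := ubnP #|X|; elim: n X => // n IHn X ltXn.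
have [->|/set0Pn[e eX]] := eqVneq X set0; first by rewrite imset0 rank0 comps0.
have <- : rank J0 (Some @: (X :\ e)) + #|comps (X :\ e)| = #|vertex G|.
  by apply: IHn; move: ltXn; rewrite (cardsD1 e X) eX.
rewrite -{1 2}(setD1K eX) imsetU1.
case: (boolP (e \in Ext (comps (X :\ e)))) => eE.
  rewrite rank_setU1_in; last exact/Ext_cocircuit.
  by rewrite (card_comps_setU1 eE) addnS.
rewrite rank_setU1_notin; first by rewrite comps_setU1_same.
by move/Ext_cocircuit; apply/negP.
Qed.

End JoinMatroid.

Theorem theorem3p8 (G : mgraph) (L : {set {set edge G}})
    (HL : linear_class L) (Hnt : ~ trivial_class L)
    (J0 : matroid (option (edge G))) (HJ0 : is_J0 L J0)
    (X : {set edge G}) :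
  (cobalanced L (comps X) ->
     ((rank (contract J0) X)%:Z = #|vertex G|%:Z - #|comps X|%:Z - 1)%R) /\
  (~ cobalanced L (comps X) ->
     ((rank (contract J0) X)%:Z = #|vertex G|%:Z - #|comps X|%:Z)%R).
Proof.
(* Only finitely many edge sets need testing, by boolean conditions, so the negated universal
   statement yields a bond constructively. *)
have not_cobalanced Y : ~ cobalanced L (comps Y) ->
    exists B, [/\ bond B, B \subset Ext (comps Y) & B \notin L].
  move=> nY.
  have [/existsP[B /and3P[]]|nB] := boolP [exists B : {set edge G},
      [&& bond B, B \subset Ext (comps Y) & B \notin L]].
    by exists B.
  case: nY => B bB sB; apply: contraNT nB => BL.
  by apply/existsP; exists B; rewrite bB sB.
(* For the empty edge set, every bond lies in [Ext], so non-triviality of [L] makes that partition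
   un-cobalanced. Hence [None] lies in a cocircuit and is not a loop. *)
have [D [cD ND _]] : exists D : {set option (edge G)},
    [/\ cocircuit J0 D, None \in D & [disjoint D & Some @: (set0 : {set edge G})]].
  apply/(None_cocircuit HJ0)/not_cobalanced => c0; apply: Hnt => B bB.
  apply: c0 => //; have [S ->] := bond_edge_cut bB.
  by rewrite delta_sub_Ext -setI_eq0 setI0.
have rN := rank_contract X (cocircuit_indep1 cD ND).
have rX := rank_Some (proj1 HL) HJ0 X.
split=> [cX|/not_cobalanced/(None_cocircuit HJ0)/rank_setU1_in rXN].
  (* No cocircuit through [None] avoids [X], so adding [None] keeps the rank and contracting it
     costs one. *)
  have /rank_setU1_notin rXN :
      ~ exists D, [/\ cocircuit J0 D, None \in D & [disjoint D & Some @: X]].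
    by move/(None_cocircuit HJ0) => -[B [bB sB]]; rewrite cX.
  by rewrite -rX -rXN rN PoszD GRing.addrK -addn1 PoszD GRing.addrK.
(* Here adding [None] raises the rank by one, which cancels the loss from contraction. *)
by move: rN; rewrite -rX rXN => -[<-]; rewrite PoszD GRing.addrK.
Qed.
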